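(* Let $\mathcal{C}$ be a permutation class and let $G_{\mathcal{C}}$ be the corresponding class of inversion graphs. Then $\mathcal{C}$ is labelled well-quasi-ordered (lwqo), in the permutation containment order, if and only if $G_{\mathcal{C}}$ is lwqo, in the induced subgraph order.
   Context: A permutation of length $n$ is an arrangement $\pi=\pi(1)\cdots\pi(n)$ of $1,\dots,n$ (the empty permutation is allowed). The permutation $\sigma$ of length $k$ is contained in $\pi$ of length $n$, written $\sigma\le\pi$, if there are indices $1\le i_1<\cdots<i_k\le n$ such that $\pi(i_1)\cdots\pi(i_k)$ is order isomorphic to $\sigma$. A permutation class is a set of permutations closed downward under containment. The inversion graph $G_\pi$ of $\pi$ (of length $n$) is the graph on $\{1,\dots,n\}$ in which $i<j$ are adjacent if and only if $\pi(i)>\pi(j)$. $G_{\mathcal{C}}=\{G_\pi:\pi\in\mathcal{C}\}$, considered up to isomorphism. A quasi-order $(Y,\le)$ is well-quasi-ordered (wqo) if every infinite sequence $y_1,y_2,\dots$ in $Y$ has indices $i<j$ with $y_i\le y_j$. Let $(L,\le_L)$ be a quasi-order. Permutations: an $L$-labelled permutation is a pair $(\pi,\ell_\pi)$ with $\pi$ of length $n$ and $\ell_\pi:\{1,\dots,n\}\to L$. We say $(\sigma,\ell_\sigma)\le(\pi,\ell_\pi)$, where $\sigma$ and $\pi$ have lengths $k$ and $n$, if there are indices $1\le i_1<\cdots<i_k\le n$ such that $\pi(i_1)\cdots\pi(i_k)$ is order isomorphic to $\sigma$ and $\ell_\sigma(j)\le_L\ell_\pi(i_j)$ for all $1\le j\le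 k$. Graphs: an $L$-labelled graph is a pair $(G,\ell_G)$ with $\ell_G:V(G)\to L$. $(H,\ell_H)$ is a labelled induced subgraph of $(G,\ell_G)$ if there is an isomorphism from $H$ onto an induced subgraph of $G$ that maps each $v\in V(H)$ to some $w\in V(G)$ with $\ell_H(v)\le_L\ell_G(w)$. A set $X$ of permutations (respectively graphs) is lwqo if, for every wqo $(L,\le_L)$, the set $X\wr L$ of all $L$-labelled members of $X$ is wqo under labelled containment (respectively the labelled induced subgraph order). *)

(* Defs.v *)
From mathcomp Require Import all_boot all_fingroup.
From Stdlib Require Import RelationClasses.

Set Implicit Arguments.
Unset Strict Implicit.
Unset Printing Implicit Defensive.

Definition wqo (Y : Type) (le : Y -> Y -> Prop) : Prop :=
  PreOrder le /\
  forall y : nat -> Y, exists i j : nat, i < j /\ le (y i) (y j).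

(* [lab L] is the set of all [L]-labelled members of some set [X], and
   [le leL] its labelled order; sharing this definition between permutations
   and graphs makes the labels range over one and the same universe. *)
Definition lwqo (lab : Type -> Type)
    (le : forall L : Type, (L -> L -> Prop) -> lab L -> lab L -> Prop) : Prop :=
  forall (L : Type) (leL : L -> L -> Prop), wqo leL -> wqo (le L leL).

(* Positions and values are numbered from 0: the entry at position [i] of [p]
   is [p i]. *)
Record permutation : Type := Permutation {
  plength : nat;
  pperm :> 'S_plength
}.

Definition embedding (s p : permutation)
    (f : 'I_(plength s) -> 'I_(plength p)) : Prop :=
  (forall i j : 'I_(plength s), i < j -> f i < f j) /\
  (forall i j : 'I_(plength s), (s i < s j) = (p (f i) < p (f j))).

Definition contained (s p : permutation) : Prop :=
  exists f, @embedding s p f.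

Definition perm_class (C : permutation -> Prop) : Prop :=
  forall s p, C p -> contained s p -> C s.

Record labelled_perm (C : permutation -> Prop) (L : Type) : Type :=
  LabelledPerm {
    lperm : permutation;
    lperm_in : C lperm;
    lperm_label : 'I_(plength lperm) -> L
  }.
Arguments lperm_label {C L} l _.

Definition labelled_contained (C : permutation -> Prop) (L : Type)
    (leL : L -> L -> Prop) (s p : labelled_perm C L) : Prop :=
  exists f, @embedding (lperm s) (lperm p) f /\
    forall j, leL (lperm_label s j) (lperm_label p (f j)).

Definition perm_lwqo (C : permutation -> Prop) : Prop :=
  lwqo (@labelled_contained C).

Record graph : Type := Graph {
  vertex : finType;
  adj : rel vertex;
  adj_sym : symmetric adj;
  adj_irr : irreflexive adj
}.

(* [f] is an isomorphism from [H] onto the subgraph of [G] induced by the image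
   of [f]. *)
Definition induced_embedding (H G : graph) (f : vertex H -> vertex G) : Prop :=
  injective f /\ forall u v, adj u v = adj (f u) (f v).

Definition isomorphic (H G : graph) : Prop :=
  exists f : vertex H -> vertex G,
    bijective f /\ forall u v, adj u v = adj (f u) (f v).

Record labelled_graph (X : graph -> Prop) (L : Type) : Type := LabelledGraph {
  lgraph : graph;
  lgraph_in : X lgraph;
  lgraph_label : vertex lgraph -> L
}.
Arguments lgraph_label {X L} l _.

Definition labelled_induced_subgraph (X : graph -> Prop) (L : Type)
    (leL : L -> L -> Prop) (H G : labelled_graph X L) : Prop :=
  exists f, @induced_embedding (lgraph H) (lgraph G) f /\
    forall v, leL (lgraph_label H v) (lgraph_label G (f v)).

Definition graph_lwqo (X : graph -> Prop) : Prop :=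
  lwqo (@labelled_induced_subgraph X).

Definition inversion (p : permutation) : rel 'I_(plength p) :=
  fun i j => (i < j) && (p j < p i) || (j < i) && (p i < p j).

Lemma inversion_sym (p : permutation) : symmetric (@inversion p).
Proof. by move=> i j; rewrite /inversion orbC. Qed.

Lemma inversion_irr (p : permutation) : irreflexive (@inversion p).
Proof. by move=> i; rewrite /inversion ltnn. Qed.

Definition inversion_graph (p : permutation) : graph :=
  Graph (@inversion_sym p) (@inversion_irr p).

(* "Up to isomorphism": the closure of the set of all [G_p] with [p] in [C]
   under isomorphism. *)
Definition inversion_graphs (C : permutation -> Prop) (G : graph) : Prop :=
  exists p, C p /\ isomorphic G (inversion_graph p).

(* Main.v *)
(** The hard direction is from graphs to permutations. Every permutation of
    length at least 2 is an inflation of a simple permutation (possibly 12 or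
    21) by intervals. In a minimal bad sequence of labelled permutations the
    intervals are wqo, so the graph of the simple quotient can be labelled by
    the intervals, together with a mark on the leftmost point, and lwqo of the
    graphs gives an embedding of one such labelled graph in a later one. The
    mark makes it an embedding of permutations: the inversions whose orientation
    it reverses form a graph each of whose nontrivial components is an interval
    that avoids the leftmost point, likewise for the non-inversions, and a
    simple permutation has no such interval. *)

Require Import Defs.
From mathcomp Require Import all_boot all_fingroup.
From mathcomp Require Import all_order ssralg ssrnum ssrint zify.
From Stdlib Require Import Classical ClassicalEpsilon RelationClasses.

Set Implicit Arguments.
Unset Strict Implicit.
Unset Printing Implicit Defensive.

(** * Infinite subsequences and marked quasi-orders *)

Definition good (X : Type) (R : X -> X -> Prop) (u : nat -> X) : Prop :=
  exists i j : nat, i < j /\ R (u i) (u j).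

Lemma infinite_subsequence (P : nat -> Prop) :
  (forall n, exists m, n <= m /\ P m) ->
  exists phi : nat -> nat, {homo phi : i j / i < j} /\ forall i, P (phi i).
Proof.
move=> H; pose next n := proj1_sig (constructive_indefinite_description _ (H n)).
have nextP n : n <= next n /\ P (next n) by
  exact: proj2_sig (constructive_indefinite_description _ (H n)).
pose phi := nat_rect (fun=> nat) (next 0) (fun _ k => next k.+1).
exists phi; split; last by case=> [|i]; apply: (nextP _).2.
by apply: (homo_ltn ltn_trans) => i; apply: (nextP _).1.
Qed.

Lemma monochromatic_subsequence (b : nat -> bool) :
  exists c (phi : nat -> nat),
    {homo phi : i j / i < j} /\ forall i, b (phi i) = c.
Proof.
case: (classic (forall n, exists m, n <= m /\ b m = true)) => [|H].
  by case/infinite_subsequence => phi H; exists true, phi.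
have [n Hn] := not_all_ex_not _ _ H.
have : forall k, exists m, k <= m /\ b m = false.
  move=> k; exists (maxn k n); rewrite leq_maxl; split=> //.
  apply/negP=> bm; apply: Hn; exists (maxn k n).
  by rewrite leq_maxr.
by case/infinite_subsequence => phi H'; exists false, phi.
Qed.

(** On a subsequence with constant mark only the first components remain to be compared. *)
Lemma wqo_marked (Z : Type) (le : Z -> Z -> Prop) :
  wqo le -> wqo (fun x y : Z * bool => le x.1 y.1 /\ x.2 = y.2).
Proof.
case=> leP le_good; split.
  split=> [x|x y z [xy exy] [yz eyz]]; first by split=> //; reflexivity.
  by split; [transitivity y.1 | rewrite exy].
move=> u; have [c [phi [phi_mono phi_c]]] :=
  monochromatic_subsequence (fun i => (u i).2).
have [i [j [ij leij]]] := le_good (fun k => (u (phi k)).1).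
by exists (phi i), (phi j); rewrite !phi_c; split; first exact: phi_mono.
Qed.

(** * Minimal bad sequences *)

Section MinimalBadSequence.

Variables (X : Type) (R : X -> X -> Prop) (sz : X -> nat).

Let bad u := ~ good R u.
Let agree n (u v : nat -> X) := forall i, i < n -> u i = v i.

Lemma minimal_at n u : bad u ->
  exists v, [/\ bad v, agree n u v &
    forall w, bad w -> agree n u w -> sz (v n) <= sz (w n)].
Proof.
move=> bad_u.
suff H k v : sz (v n) < k -> bad v -> agree n u v ->
    exists v, [/\ bad v, agree n u v &
      forall w, bad w -> agree n u w -> sz (v n) <= sz (w n)].
  exact: (H (sz (u n)).+1 u).
elim: k v => // k IH v ltvk bad_v uv.
case: (classic (exists w, [/\ bad w, agree n u w & sz (w n) < sz (v n)])).
  by case=> w [bad_w uw ltwv]; apply: (IH w) => //; apply: leq_trans ltwv _.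
move=> H; exists v; split=> // w bad_w uw; rewrite leqNgt.
by apply/negP=> ltwv; apply: H; exists w.
Qed.

Lemma minimal_bad_sequence u : bad u ->
  exists v, bad v /\
    forall n w, bad w -> agree n v w -> sz (v n) <= sz (w n).
Proof.
move=> bad_u.
have choose n (s : {v | bad v}) : {v | bad v /\ (agree n (sval s) v /\
    forall w, bad w -> agree n (sval s) w -> sz (v n) <= sz (w n))}.
  apply: constructive_indefinite_description.
  by have [v [? ? ?]] := minimal_at n (proj2_sig s); exists v.
pose step n s : {v | bad v} :=
  exist _ (sval (choose n s)) (proj1 (proj2_sig (choose n s))).
(* [M n] is a bad sequence whose entry [n] is as small as its earlier entries permit. Later stages
   keep the entries up to [n], so the diagonal [v] is bad and minimal. *)
pose M := nat_rect (fun=> {v | bad v}) (step 0 (exist _ u bad_u))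
  (fun n => step n.+1).
have M_agree n : agree n.+1 (sval (M n)) (sval (M n.+1)).
  by case: (proj2_sig (choose n.+1 (M n))) => _ [].
pose v n := sval (M n) n.
have vM i k : i <= k -> sval (M k) i = v i.
  elim: k => [|k IH]; first by rewrite leqn0 => /eqP->.
  rewrite leq_eqVlt => /orP[/eqP-> //|ik].
  by rewrite -IH // -M_agree.
exists v; split.
  case=> i [j [ij Rij]]; apply: (proj2_sig (M j)); exists i, j.
  by rewrite !vM // ltnW.
case=> [|n] w bad_w vw.
  by case: (proj2_sig (choose 0 (exist _ u bad_u))) => _ [_]; apply.
case: (proj2_sig (choose n.+1 (M n))) => _ [_]; apply=> // i ltin.
by rewrite vM // vw.
Qed.

(** A bad sequence of [sub]-parts of a minimal bad [u], spliced onto an initial segment of [u],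
    would give a bad sequence that is smaller at the splice. *)
Lemma nash_williams (sub : X -> X -> Prop) :
  PreOrder R ->
  (forall x y, sub x y -> sz x < sz y /\ R x y) ->
  (forall u, (forall v, (forall k, exists i, sub (v k) (u i)) -> good R v) ->
    good R u) ->
  forall u, good R u.
Proof.
move=> Rpre subP step u0; apply: NNPP => /minimal_bad_sequence[u [bad_u minu]].
apply: (bad_u); apply: step => v /= vsub; apply: NNPP => bad_v.
pose iota k := sval (constructive_indefinite_description _ (vsub k)).
have iotaP k : sub (v k) (u (iota k)) by
  exact: proj2_sig (constructive_indefinite_description _ (vsub k)).
(* Splicing at the least index [iota k0] puts every earlier [i] before all [iota k], so that [u i]
   below [v k] would give a good pair of [u] by transitivity. *)
have [k0 k0min] : exists k0, forall k, iota k0 <= iota k.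
  suff H m k : iota k < m -> exists k0, forall k, iota k0 <= iota k.
    exact: (H _ 0 (ltnSn _)).
  elim: m k => // m IH k ltkm.
  case: (classic (exists k', iota k' < iota k)) => [[k' lt]|H].
    by apply: (IH k'); apply: leq_trans lt _.
  exists k => k'; rewrite leqNgt; apply/negP=> lt; apply: H.
  by exists k'.
pose n0 := iota k0.
pose w i := if i < n0 then u i else v (k0 + (i - n0)).
have : sz (u n0) <= sz (w n0).
  apply: minu => [|i lti]; last by rewrite /w lti.
  case=> i [j [ij]]; rewrite /w; case: ltnP => [lti|gei]; case: ltnP => [ltj|gej].
  - by move=> Rij; apply: bad_u; exists i, j.
  - move=> Rij; apply: bad_u.
    exists i, (iota (k0 + (j - n0))); split.
      by apply: leq_trans lti (k0min _).
    by transitivity (v (k0 + (j - n0))) => //; case: (subP _ _ (iotaP (k0 + (j - n0)))).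
  - by have := leq_trans (ltn_trans ij ltj) gei; rewrite ltnn.
  - move=> Rij; apply: bad_v; exists (k0 + (i - n0)), (k0 + (j - n0)).
    by split=> //; lia.
rewrite /w ltnn subnn addn0 leqNgt; case: (subP _ _ (iotaP k0)) => lt _.
by rewrite lt.
Qed.

End MinimalBadSequence.

(** * Embeddings, and patterns on sets of positions *)

Lemma embedding_ltn (s p : permutation) (h : 'I_(plength s) -> 'I_(plength p)) :
  embedding h -> forall i j, (h i < h j) = (i < j).
Proof.
case=> h_mono _ i j; case: (ltngtP i j) => [/h_mono-> //|/h_mono lt|].
  by apply/negbTE; rewrite -leqNgt ltnW.
by move/val_inj->; rewrite ltnn.
Qed.

Lemma embedding_inj (s p : permutation) (h : 'I_(plength s) -> 'I_(plength p)) :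
  embedding h -> injective h.
Proof.
move=> /embedding_ltn hlt i j eq_h; apply/val_inj.
by case: (ltngtP i j) => //; rewrite -hlt eq_h ltnn.
Qed.

Lemma embedding_inversion (s p : permutation)
    (h : 'I_(plength s) -> 'I_(plength p)) :
  embedding h -> @induced_embedding (inversion_graph s) (inversion_graph p) h.
Proof.
move=> hP; split; first exact: embedding_inj hP.
by move=> i j; rewrite /= /inversion !(embedding_ltn hP) !hP.2.
Qed.

Lemma enum_sorted n (A : {set 'I_n}) :
  sorted ltn [seq val i | i <- enum A].
Proof.
have -> : enum A = [seq i <- enum 'I_n | i \in A] by rewrite [enum 'I_n]enumT.
rewrite sorted_map; apply: sorted_filter; first by move=> ? ? ?; apply: ltn_trans.
by rewrite -sorted_map val_enum_ord; apply: iota_ltn_sorted.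
Qed.

Lemma enum_val_ltn n (A : {set 'I_n}) (i j : 'I_#|A|) :
  i < j -> enum_val i < enum_val j.
Proof.
move=> lt_ij; have x0 := enum_default i; rewrite !(enum_val_nth x0).
have := @sorted_ltn_nth _ _ ltn_trans 0 _ (enum_sorted A) i j.
rewrite !inE size_map -cardE !ltn_ord => /(_ isT isT lt_ij).
by rewrite !(nth_map x0) -?cardE.
Qed.

Lemma restriction (p : permutation) (A : {set 'I_(plength p)}) :
  exists (s : permutation) (h : 'I_(plength s) -> 'I_(plength p)),
    [/\ embedding h, plength s = #|A|, forall k, h k \in A &
        forall x, x \in A -> exists k, h k = x].
Proof.
(* The pattern takes at [k] the number of points of [A] whose value lies below that of the point
   listed at [k]. *)
pose below (k : 'I_#|A|) := [set y in A | p y < p (enum_val k)].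
have below_lt k : #|below k| < #|A|.
  apply: proper_card; apply/properP; split.
    by apply/subsetP=> y; rewrite inE => /andP[].
  by exists (enum_val k); rewrite ?enum_valP // inE ltnn andbF.
have below_mono i j : p (enum_val i) < p (enum_val j) -> #|below i| < #|below j|.
  move=> lt_ij; apply: proper_card; apply/properP; split.
    by apply/subsetP=> y; rewrite !inE => /andP[-> /ltn_trans]; apply.
  by exists (enum_val i); rewrite inE ?ltnn ?andbF // enum_valP.
pose rank k := Ordinal (below_lt k).
have rankE i j : (rank i < rank j) = (p (enum_val i) < p (enum_val j)).
  case: (ltngtP (p (enum_val i)) (p (enum_val j))) => [/below_mono //|/below_mono|].
    by move=> lt; apply/negbTE; rewrite -leqNgt ltnW.
  by move/val_inj/perm_inj/enum_val_inj->; rewrite ltnn.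
have rank_inj : injective rank.
  move=> i j eq_ij; apply/enum_val_inj/(@perm_inj _ p)/val_inj.
  by case: (ltngtP (p (enum_val i)) (p (enum_val j))) => //; rewrite -rankE eq_ij ltnn.
exists (Permutation (perm rank_inj)), enum_val; split=> //.
- split=> [i j|i j]; first exact: enum_val_ltn.
  by rewrite /= !permE rankE.
- exact: enum_valP.
- by move=> x Ax; exists (enum_rank_in Ax x); apply: enum_rankK_in.
Qed.

(** * Reorientations of inversion graphs *)

Lemma connect_crossing (T : finType) (e : rel T) (P : pred T) (x y : T) :
  connect e x y -> P x -> ~~ P y ->
  exists z w, [/\ connect e x z, e z w, P z & ~~ P w].
Proof.
case/connectP=> c; elim: c x => [|z c IH] x /=; first by move=> _ -> ->.
case/andP=> exz pc lasty Px NPy.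
case Pz: (P z); last by exists x, z; rewrite connect0 exz Px Pz.
have [u [w [zu uw Pu NPw]]] := IH z pc lasty Pz NPy.
by exists u, w; split=> //; apply: connect_trans zu; apply: connect1.
Qed.

Section Reorientation.

Import GRing.Theory Num.Theory Order.TTheory.
Local Open Scope ring_scope.

(** A permutation is treated as two linear orders given by maps to the integers, so that reversing
    the second order is negation. *)
Definition inverted (T : Type) (a b : T -> int) (x y : T) : bool :=
  (a x < a y) && (b y < b x) || (a y < a x) && (b x < b y).

(** Sets convex in both orders are the intervals, so this is simplicity. *)
Definition no_proper_interval (T : finType) (a b : T -> int) : Prop :=
  forall I : {set T}, (1 < #|I|)%N ->
    (forall x y z, x \in I -> y \in I ->
      (a x < a z < a y) \/ (b x < b z < b y) -> z \in I) ->
    I = setT.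

(* Also used with [b] and [b'] negated, where the inversions are the
   non-inversions of the original orders. *)
Lemma orientation_forced (T : finType) (a b a' b' : T -> int) (l : T) :
  injective a -> injective b -> injective a' -> injective b' ->
  inverted a b =2 inverted a' b' -> no_proper_interval a b ->
  (forall x, x != l -> a l < a x /\ a' l < a' x) ->
  forall x y, a x < a y -> b y < b x -> a' x < a' y.
Proof.
move=> inj_a inj_b inj_a' inj_b' same simple leftmost x y axy byx.
have neq z w : z != w ->
    [/\ a z <> a w, b z <> b w, a' z <> a' w & b' z <> b' w].
  by move/eqP=> zw; split=> [/inj_a|/inj_b|/inj_a'|/inj_b'].
case: (ltP (a' x) (a' y)) => // ayx'.
(* [D] joins the inversions that [a] and [a'] order differently; the case to refute puts [x] and [y]
   among them. *)
pose D z w := inverted a b z w && ((a z < a w) != (a' z < a' w)).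
have Dsym : symmetric D.
  move=> z w; rewrite /D /inverted; case: (eqVneq z w) => [-> //|].
  case/neq; lia.
have csym : connect_sym D := sym_connect_sym Dsym.
have Dxy : D x y by rewrite /D /inverted axy byx /=; lia.
have xl : x != l.
  apply/eqP=> xl; have yl : y != l by apply/eqP=> yl; move: axy; rewrite xl yl ltxx.
  by have [_] := leftmost _ yl; rewrite -xl ltNge ayx'.
(* The component of [x] contains [y]. It is shown to be an interval that avoids [l], since no pair
   in [D] involves a point that is first for both [a] and [a']. *)
pose K := [set z | connect D x z].
have inK z w : z \in K -> connect D z w -> w \in K.
  by rewrite !inE; apply: connect_trans.
have linK z w : z \in K -> w \in K -> connect D z w.
  by rewrite !inE csym; apply: connect_trans.
have KD z w : z \in K -> w \notin K -> ~~ D z w.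
  by move=> Kz; apply: contra => /connect1; apply: inK.
have lK : l \notin K.
  apply/negP; rewrite inE => xcl.
  have [//|z [w [_ Dzw zl /negbNE/eqP wl]]] := connect_crossing (P := predC1 l) xcl xl _.
    by rewrite /= eqxx.
  by move: Dzw; rewrite wl /D; have := leftmost _ zl; lia.
suff KT : K = setT by rewrite KT inE in lK.
apply: simple => [|z1 z2 c Kz1 Kz2 btw].
  rewrite (cardD1 x) (cardD1 y) !inE connect0 (connect1 Dxy) andbT.
  by case: eqVneq axy => // ->; rewrite ltxx.
apply/negPn/negP=> NKc.
(* If [c] lay between [u] and [w], then the pairs [u c] and [c w], whose
   orientation is kept, would force by transitivity that of [u w]. *)
have nocross u w : u \in K -> w \in K -> D u w ->
    ~ (a u < a c < a w) /\ ~ (b u < b c < b w).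
  move=> Ku Kw.
  have uc : u != c by apply: contra NKc => /eqP<-.
  have wc : w != c by apply: contra NKc => /eqP<-.
  have := KD _ _ Ku NKc; have := KD _ _ Kw NKc.
  have := same u c; have := same w c; have := same u w.
  have [] := neq _ _ uc; have [] := neq _ _ wc.
  rewrite /D /inverted; lia.
(* If [c] lies between two points of [K] in one of the orders, a path of [D] joining them has an
   edge that passes over [c] in that order. *)
have z12 := linK _ _ Kz1 Kz2.
case: btw => /andP[lt1 lt2].
  have [//||u [w [z1u Duw au aw]]] := connect_crossing (P := fun z => a z < a c) z12.
    by rewrite -leNgt ltW.
  have Ku := inK _ _ Kz1 z1u; have Kw := inK _ _ Ku (connect1 Duw).
  have [nab _] := nocross u w Ku Kw Duw; case: nab; rewrite au lt_neqAle leNgt aw andbT.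
  by apply/eqP=> /inj_a cw; rewrite cw Kw in NKc.
have [//||u [w [z1u Duw bu bw]]] := connect_crossing (P := fun z => b z < b c) z12.
  by rewrite -leNgt ltW.
have Ku := inK _ _ Kz1 z1u; have Kw := inK _ _ Ku (connect1 Duw).
have [_ nab] := nocross u w Ku Kw Duw; case: nab; rewrite bu lt_neqAle leNgt bw andbT.
by apply/eqP=> /inj_b cw; rewrite cw Kw in NKc.
Qed.

End Reorientation.

(** * Simple permutations with a marked leftmost point *)

(** All permutations of length at most 2 qualify, including 0 and 1, so a lower bound on the length
    is carried separately. *)
Definition simple (s : permutation) : Prop :=
  forall I : {set 'I_(plength s)}, 1 < #|I| ->
    (forall x y z : 'I_(plength s), x \in I -> y \in I ->
      x < z < y \/ s x < s z < s y -> z \in I) ->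
    I = setT.

(** [orientation_forced] is applied to the inversions and, with values negated, to the
    non-inversions. So positions keep their order, and the values follow because inversions are
    preserved. *)
Lemma marked_simple_embedding (s t : permutation)
    (f : 'I_(plength s) -> 'I_(plength t)) (l : 'I_(plength s)) :
  simple s -> @induced_embedding (inversion_graph s) (inversion_graph t) f ->
  (forall x, x != l -> l < x) -> (forall x, x != l -> f l < f x) ->
  embedding f.
Proof.
move=> s_simple [f_inj f_adj] l_left fl_left.
pose pos (x : 'I_(plength s)) := Posz (nat_of_ord x); pose val_ x := Posz (nat_of_ord (s x)).
pose pos' x := Posz (nat_of_ord (f x)); pose val' x := Posz (nat_of_ord (t (f x))).
have inj_pos : injective pos by move=> x y [] /val_inj.
have inj_val : injective val_ by move=> x y [] /val_inj/perm_inj.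
have inj_pos' : injective pos' by move=> x y [] /val_inj/f_inj.
have inj_val' : injective val' by move=> x y [] /val_inj/perm_inj/f_inj.
have neq x y : x != y -> [/\ pos x <> pos y, val_ x <> val_ y,
    pos' x <> pos' y & val' x <> val' y].
  by move/eqP=> xy; split=> [/inj_pos|/inj_val|/inj_pos'|/inj_val'].
have same x y : inverted pos val_ x y = inverted pos' val' x y.
  by have := f_adj x y; rewrite /= /inversion /inverted /pos /val_ /pos' /val'; lia.
have inj_opp g : injective g -> injective (fun x : 'I_(plength s) => GRing.opp (g x) : int).
  by move=> inj_g x y /GRing.oppr_inj/inj_g.
have left x : x != l -> (pos l < pos x)%R /\ (pos' l < pos' x)%R.
  by move=> xl; split; [apply: l_left | apply: fl_left].
have inv_pos x y : s y < s x -> x < y -> f x < f y.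
  move=> *; apply: (@orientation_forced _ pos val_ pos' val' l) => //; exact: s_simple.
have noninv_pos x y : s x < s y -> x < y -> f x < f y.
  move=> *; apply: (@orientation_forced _ pos (fun x => - val_ x)%R
      pos' (fun x => - val' x)%R l) => //.
  - exact: inj_opp.
  - exact: inj_opp.
  - move=> u v; have := same u v; rewrite /inverted.
    by case: (eqVneq u v) => [-> //|/neq[]]; lia.
  - move=> I I_gt1 I_int; apply: s_simple => // u v w Iu Iv btw.
    case: btw => btw; first by apply: (I_int u v) => //; left.
    (* Negating the values exchanges the two ends. *)
    by apply: (I_int v u) => //; right; rewrite /val_; lia.
  by rewrite /val_; lia.
have mono (x y : 'I_(plength s)) : x < y -> f x < f y.
  move=> xy; have [sxy|syx|/val_inj/perm_inj eq_xy] := ltngtP (s x) (s y).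
  - exact: noninv_pos.
  - exact: inv_pos.
  - by rewrite eq_xy ltnn in xy.
split=> // x y; case: (eqVneq x y) => [->|xy]; first by rewrite !ltnn.
have := same x y; have := mono x y; have := mono y x; have := neq _ _ xy.
by rewrite /inverted /pos /val_ /pos' /val' => -[]; lia.
Qed.

(** * Simple quotients of patterns *)

(* The fibres of [q] on [B] are intervals of the pattern of [p] on [B], and [s]
   is the quotient by them. *)
Definition quotient_map (s p : permutation) (B : {set 'I_(plength p)})
    (h : 'I_(plength s) -> 'I_(plength p))
    (q : 'I_(plength p) -> 'I_(plength s)) : Prop :=
  [/\ embedding h, forall k, h k \in B, cancel h q &
      forall x y, x \in B -> y \in B -> q x != q y ->
        (x < y) = (q x < q y) /\ (p x < p y) = (s (q x) < s (q y))].

Lemma quotient_map_comp (t s p : permutation) (B : {set 'I_(plength p)}) h q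
    (h' : 'I_(plength t) -> 'I_(plength s)) q' :
  @quotient_map s p B h q -> quotient_map setT h' q' ->
  quotient_map B (h \o h') (q' \o q).
Proof.
case=> hP hB hq qP [h'P _ h'q' q'P]; split.
- split=> [i j ij|i j] /=; first by apply: hP.1; apply: h'P.1.
  by rewrite h'P.2 hP.2.
- by move=> k; apply: hB.
- exact: can_comp.
move=> x y Bx By /= neq_q'.
have neq_q : q x != q y by apply: contra neq_q' => /eqP->.
have [-> ->] := qP x y Bx By neq_q.
by apply: q'P; rewrite ?inE.
Qed.

(** The quotient is realised as the pattern on the set [A] of representatives, and [q] as [r]
    followed by the inverse of [h]. Off [B], [r] may take any values in [A]. *)
Lemma quotient_of_retraction (p : permutation) (A B : {set 'I_(plength p)})
    (r : 'I_(plength p) -> 'I_(plength p)) :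
  A \subset B -> (forall x, r x \in A) -> {in A, forall x, r x = x} ->
  (forall x y, x \in B -> y \in B -> r x != r y ->
    (x < y) = (r x < r y) /\ (p x < p y) = (p (r x) < p (r y))) ->
  exists s h q, @quotient_map s p B h q /\ plength s = #|A|.
Proof.
move=> /subsetP AB rA rK rP.
have [s [h [hP sA hA h_onto]]] := restriction A.
have [q qP] := fin_all_exists (fun x => h_onto (r x) (rA x)).
exists s, h, q; split=> //; split=> //.
- by move=> k; apply: AB.
- by move=> k; apply: (embedding_inj hP); rewrite qP rK.
move=> x y Bx By neq_q.
have neq_r : r x != r y.
  by rewrite -!qP; apply: contra neq_q => /eqP/(embedding_inj hP)->.
have [-> ->] := rP x y Bx By neq_r.
by rewrite -!qP (embedding_ltn hP) hP.2.
Qed.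

Lemma contract_interval (s : permutation) : ~ simple s ->
  exists t h q, @quotient_map t s setT h q /\ 1 < plength t < plength s.
Proof.
move/not_all_ex_not=> [I nI].
have [I_gt1 nI'] := imply_to_and _ _ nI.
have {nI nI'}[I_int I_neqT] := imply_to_and _ _ nI'.
have [c cI] : exists c, c \in I by apply/card_gt0P; apply: ltnW.
pose r x := if x \in I then c else x.
(* A point outside an interval does not separate its points in position or value, so the whole of
   [I] can be collapsed onto [c]. *)
have outside u v y : u \in I -> v \in I -> y \notin I ->
    [/\ (u < y) = (v < y), (y < u) = (y < v),
        (s u < s y) = (s v < s y) & (s y < s u) = (s y < s v)].
  move=> uI vI yI.
  have neq w : w \in I -> nat_of_ord w <> y /\ nat_of_ord (s w) <> s y.
    by move=> wI; split=> [/val_inj|/val_inj/perm_inj] wy; rewrite -wy wI in yI.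
  have nb w w' : w \in I -> w' \in I -> ~~ (w < y < w') /\ ~~ (s w < s y < s w').
    by move=> wI w'I; split; apply: contra yI => btw; apply: (I_int w w') => //;
      [left | right].
  have := neq _ uI; have := neq _ vI; have := nb _ _ uI vI; have := nb _ _ vI uI.
  by split; lia.
have [||x|x|t [h [q [qP tA]]]] :=
  @quotient_of_retraction s (c |: ~: I) setT r.
- exact: subsetT.
- by move=> x; rewrite /r; case: ifP => xI; rewrite !inE ?eqxx // xI orbT.
- by rewrite !inE /r => /orP[/eqP->|/negbTE->] //; case: ifP.
- move=> y _ _; rewrite /r; case: ifP => xI; case: ifP => yI //.
  + by rewrite eqxx.
  + by have [-> _ -> _] := outside x c y xI cI (negbT yI).
  + by have [_ -> _ ->] := outside y c x yI cI (negbT xI).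
(* The representatives are [c] and the points off [I]: at least two because [I] is not everything,
   and not all because [I] has two points. *)
exists t, h, q; split=> //; rewrite tA cardsU1 !inE cI /= add1n ltnS.
have := cardsC I; rewrite card_ord => cI_eq.
apply/andP; split; last first.
  by rewrite -[ltnRHS]cI_eq -add2n leq_add2r.
rewrite lt0n cards_eq0 -(inj_eq (inv_inj setCK)) setCK setC0.
by apply/eqP.
Qed.

(** Starting from the pattern on [B], intervals are contracted until none is left; each contraction
    shortens the quotient but leaves more than one point. *)
Lemma simple_quotient_exists (p : permutation) (B : {set 'I_(plength p)}) :
  1 < #|B| ->
  exists s h q, [/\ @quotient_map s p B h q, simple s & 1 < plength s].
Proof.
move=> B_gt1.
have [x0 Bx0] : exists x, x \in B by apply/card_gt0P; apply: ltnW.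
have [||x|x y Bx By|s0 [h0 [q0 [q0P s0B]]]] :=
  @quotient_of_retraction p B B (fun x => if x \in B then x else x0).
- by [].
- by move=> x; case: ifP.
- by move=> ->.
- by rewrite Bx By.
have : 1 < plength s0 by rewrite s0B.
have [n] := ubnP (plength s0); elim: n s0 h0 q0 q0P {s0B} => // n IH s h q qP.
rewrite ltnS => ltsn s_gt1.
case: (classic (simple s)) => [s_simple|]; first by exists s, h, q.
case/contract_interval=> t [h' [q' [q'P /andP[t_gt1 lts]]]].
apply: (IH t _ _ (quotient_map_comp qP q'P)) => //.
exact: leq_trans lts ltsn.
Qed.

(** * Well-quasi-order of labelled point sets *)

Section PointSets.

Variables (C : permutation -> Prop) (L : Type) (leL : L -> L -> Prop).
Hypothesis hC : perm_class C.
Hypothesis leL_wqo : wqo leL.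

(** Patterns are kept as sets of positions in a fixed labelled permutation, so that passing to a
    block renumbers neither points nor labels. *)
Record point_set : Type := PointSet {
  base : labelled_perm C L;
  points : {set 'I_(plength (lperm base))};
  points_neq0 : points != set0
}.

(** This is labelled containment between the patterns on the two sets; elsewhere [F] is
    arbitrary. *)
Definition points_le (e e' : point_set) : Prop :=
  exists F : 'I_(plength (lperm (base e))) -> 'I_(plength (lperm (base e'))),
    (forall x, x \in points e ->
       F x \in points e' /\ leL (lperm_label _ x) (lperm_label _ (F x))) /\
    (forall x y, x \in points e -> y \in points e ->
       (x < y) = (F x < F y) /\
       (lperm (base e) x < lperm (base e) y) =
       (lperm (base e') (F x) < lperm (base e') (F y))).

Definition proper_part (e' e : point_set) : Prop :=
  exists (A : {set 'I_(plength (lperm (base e)))}) (A0 : A != set0),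
    A \proper points e /\ e' = PointSet A0.

Let leL_refl x : leL x x.
Proof. by have [leL_refl _] := leL_wqo.1; apply: leL_refl. Qed.

Let leL_trans x y z : leL x y -> leL y z -> leL x z.
Proof. by have [_ leL_trans] := leL_wqo.1; apply: leL_trans. Qed.

Lemma points_le_preorder : PreOrder points_le.
Proof.
split=> [e|e1 e2 e3 [F [FP F_lt]] [G [GP G_lt]]].
  by exists id; split.
exists (G \o F); split=> [x e1x|x y e1x e1y] /=.
  have [e2x Fle] := FP x e1x; have [e3x Gle] := GP _ e2x.
  by split=> //; apply: leL_trans Fle Gle.
have [e2x _] := FP x e1x; have [e2y _] := FP y e1y.
have [-> ->] := F_lt x y e1x e1y.
exact: G_lt.
Qed.

Lemma proper_part_le e' e :
  proper_part e' e -> #|points e'| < #|points e| /\ points_le e' e.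
Proof.
case=> A [A0 [Ae ->]] /=; split; first exact: proper_card.
exists id; split=> //= x Ax; split=> //.
exact: (subsetP (proper_sub Ae)).
Qed.

Lemma singletons_good (u : nat -> point_set) :
  (forall i, #|points (u i)| = 1) -> good points_le u.
Proof.
move=> u1.
have pick i : {x | points (u i) = [set x]}.
  apply: constructive_indefinite_description.
  by apply/cards1P/eqP.
have [i [j [ij le_ij]]] := leL_wqo.2 (fun i => lperm_label _ (sval (pick i))).
exists i, j; split=> //; move: le_ij.
case: (pick i) (pick j) => [x xP] [y yP] /= le_xy.
exists (fun=> y); split=> [z|z w]; rewrite xP.
  by move/set1P->; rewrite yP set11.
by move=> /set1P-> /set1P->; rewrite !ltnn.
Qed.

Record simple_quotient (e : point_set) : Type := SimpleQuotient {
  quo : permutation;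
  section : 'I_(plength quo) -> 'I_(plength (lperm (base e)));
  proj : 'I_(plength (lperm (base e))) -> 'I_(plength quo);
  quoP : @quotient_map quo (lperm (base e)) (points e) section proj;
  quo_simple : simple quo;
  quo_gt1 : 1 < plength quo
}.
Arguments section {e} s _.
Arguments proj {e} s _.

Lemma simple_quotientP e : 1 < #|points e| -> inhabited (simple_quotient e).
Proof.
by case/simple_quotient_exists=> s [h [q [qP ss s_gt1]]]; exists; exists s h q.
Qed.

Section Blocks.

Variables (e : point_set) (Q : simple_quotient e).

Definition block (k : 'I_(plength (quo Q))) :
  {set 'I_(plength (lperm (base e)))} := [set x in points e | proj Q x == k].

Lemma section_block k : section Q k \in block k.
Proof. by have [_ he qK _] := quoP Q; rewrite inE he qK eqxx. Qed.

Lemma block_neq0 k : block k != set0.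
Proof. by apply/set0Pn; exists (section Q k); apply: section_block. Qed.

Lemma block_proper k : proper_part (PointSet (block_neq0 k)) e.
Proof.
exists (block k), (block_neq0 k); split=> //; apply/properP; split.
  by apply/subsetP=> x; rewrite inE => /andP[].
have [k' k'k] : exists k', k' != k.
  have : 0 < #|[set~ k]|.
    by rewrite cardsC1 card_ord; have := quo_gt1 Q; case: (plength _) => [|[]].
  by case/card_gt0P=> k'; rewrite !inE; exists k'.
have [_ he qK _] := quoP Q.
by exists (section Q k'); rewrite ?he // inE he qK.
Qed.

Definition leftmost (k : 'I_(plength (quo Q))) : bool := val k == 0.

(** The section embeds the quotient in the base, so downward closure applies. *)
Lemma quo_in : C (quo Q).
Proof.
apply: hC (lperm_in (base e)) _; exists (section Q).
by have [] := quoP Q.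
Qed.

End Blocks.

Section Step.

Variable u : nat -> point_set.
Hypothesis parts_good :
  forall v, (forall k, exists i, proper_part (v k) (u i)) -> good points_le v.

(** These label the points of the quotient graphs; [parts_good] is what makes them wqo. *)
Definition part : Type := {e | exists i, proper_part e (u i)}.

Definition part_le (x y : part) : Prop := points_le (sval x) (sval y).

Lemma part_wqo : wqo part_le.
Proof.
have [le_refl le_trans] := points_le_preorder.
split; last by move=> v; apply: parts_good => k; apply: (svalP (v k)).
by split=> [x|x y z]; [apply: le_refl | apply: le_trans].
Qed.

Variable Q : forall i, simple_quotient (u i).

Definition block_part i (k : 'I_(plength (quo (Q i)))) : part :=
  exist _ (PointSet (block_neq0 k)) (ex_intro _ i (block_proper k)).

Lemma quo_graph_in i : inversion_graphs C (inversion_graph (quo (Q i))).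
Proof.
exists (quo (Q i)); split; first exact: quo_in.
by exists id; split=> //; exists id.
Qed.

Definition quo_graph i : labelled_graph (inversion_graphs C) (part * bool) :=
  @LabelledGraph (inversion_graphs C) (part * bool)
    (inversion_graph (quo (Q i))) (quo_graph_in i)
    (fun k => (@block_part i k, leftmost k)).

(** The embedding of quotients assigns to each block of [u i] a block of [u j], the labels embed the
    former in the latter, and these maps glue. *)
Lemma quo_graph_le i j :
  labelled_induced_subgraph
    (fun x y : part * bool => part_le x.1 y.1 /\ x.2 = y.2)
    (quo_graph i) (quo_graph j) ->
  points_le (u i) (u j).
Proof.
case=> f [f_ind f_lab].
change ('I_(plength (quo (Q i))) -> 'I_(plength (quo (Q j)))) in f.
have f_emb : embedding f.
  have i_gt0 : 0 < plength (quo (Q i)) by apply: ltnW (quo_gt1 _).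
  pose l := Ordinal i_gt0.
  have left_lt n (k m : 'I_n) : val k == 0 -> m != k -> k < m.
    by move=> /eqP k0; rewrite -val_eqE /= k0 lt0n.
  apply: (@marked_simple_embedding _ _ f l) => //; first exact: quo_simple.
    by move=> x; apply: left_lt.
  move=> x xl; apply: left_lt; last by rewrite (inj_eq f_ind.1).
  (* The mark is preserved, so [f l] is the leftmost point of its quotient. *)
  by have [_ /= marked] := f_lab l; rewrite -[_ == _]marked.
have [_ _ qi_K qi_lt] := quoP (Q i); have [_ _ qj_K qj_lt] := quoP (Q j).
have /fin_all_exists[g gP] k := (f_lab k).1.
pose qi := proj (Q i); pose qj := proj (Q j).
have in_block x : x \in points (u i) -> x \in block (Q := Q i) (qi x).
  by move=> xi; rewrite inE xi eqxx.
pose F x := g (qi x) x.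
have FP x : x \in points (u i) ->
    [/\ F x \in points (u j), qj (F x) = f (qi x) &
        leL (lperm_label _ x) (lperm_label _ (F x))].
  move=> xi; have [+ le_x] := (gP (qi x)).1 x (in_block x xi).
  by rewrite inE => /andP[? /eqP ?].
exists F; split=> [x /FP[? _ ?] //|x y xi yi].
(* Within a block its own embedding decides; across blocks both comparisons are read off in the
   quotients. *)
case: (eqVneq (qi x) (qi y)) => [qxy|qxy].
  have yb := in_block y yi; rewrite -qxy in yb.
  by have := (gP (qi x)).2 x y (in_block x xi) yb; rewrite /F -qxy.
have [Fxj qFx _] := FP x xi; have [Fyj qFy _] := FP y yi.
have qFxy : qj (F x) != qj (F y).
  by rewrite qFx qFy (inj_eq (embedding_inj f_emb)).
have [-> ->] := qi_lt x y xi yi qxy.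
have [-> ->] := qj_lt _ _ Fxj Fyj qFxy.
by rewrite -/qj qFx qFy (embedding_ltn f_emb) f_emb.2.
Qed.

End Step.

Lemma points_good : graph_lwqo (inversion_graphs C) ->
  forall u, good points_le u.
Proof.
move=> G_lwqo; apply: (@nash_williams _ _ (fun e => #|points e|) proper_part).
- exact: points_le_preorder.
- exact: proper_part_le.
move=> u parts_good.
have good_sub phi : {homo phi : i j / i < j} ->
    good points_le (fun i => u (phi i)) -> good points_le u.
  by move=> phi_mono [i [j [/phi_mono ij le_ij]]]; exists (phi i), (phi j).
(* One-point sets have no quotient of length above 1, so a subsequence is taken in which all sets or
   none are singletons. *)
have [c [phi [phi_mono phi_c]]] :=
  monochromatic_subsequence (fun i => #|points (u i)| == 1).
apply: (good_sub phi phi_mono).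
case: c phi_c => phi_c; first by apply: singletons_good => i; apply/eqP.
have Q i : simple_quotient (u (phi i)).
  apply: (epsilon _ (fun=> True)); apply: simple_quotientP.
  have := points_neq0 (u (phi i)); rewrite -card_gt0.
  by have := phi_c i; case: #|_| => [|[]].
have parts_good' v : (forall k, exists i, proper_part (v k) (u (phi i))) ->
    good points_le v.
  by move=> vP; apply: parts_good => k; have [i] := vP k; exists (phi i).
have [i [j [ij le_ij]]] :=
  (G_lwqo _ _ (wqo_marked (part_wqo parts_good'))).2 (quo_graph Q).
by exists i, j; split=> //; apply: quo_graph_le le_ij.
Qed.

End PointSets.

(** * The two implications *)

Lemma perm_lwqo_of_graph_lwqo (C : permutation -> Prop) : perm_class C ->
  graph_lwqo (inversion_graphs C) -> perm_lwqo C.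
Proof.
move=> hC G_lwqo L leL leL_wqo; have [leL_refl leL_trans] := leL_wqo.1.
split.
  split=> [p|p q r [f [[f_mono f_lt] f_lab]] [g [[g_mono g_lt] g_lab]]].
    by exists id; split=> // j; apply: leL_refl.
  exists (g \o f); split; first split=> i j /=.
  - by move=> ij; apply/g_mono/f_mono.
  - by rewrite f_lt g_lt.
  - by move=> j; apply: leL_trans (f_lab j) (g_lab _).
move=> w.
(* An empty permutation gives no [point_set], but is contained in the next term whatever that is. *)
case: (classic (exists i, plength (lperm (w i)) = 0)) => [[i i0]|w_gt0].
  have absurd T : 'I_(plength (lperm (w i))) -> T by rewrite i0; case.
  exists i, i.+1; split=> //; exists (absurd _); split; first split.
  - by move=> x; apply: (absurd _ x).
  - by move=> x; apply: (absurd _ x).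
  - by move=> x; apply: (absurd _ x).
have wT i : [set: 'I_(plength (lperm (w i)))] != set0.
  rewrite -card_gt0 cardsT card_ord lt0n; apply/eqP=> i0.
  by apply: w_gt0; exists i.
have [i [j [ij [F [F_lab F_lt]]]]] :=
  points_good hC leL_wqo G_lwqo (fun i => PointSet (wT i)).
exists i, j; split=> //; exists F; split; last first.
  by move=> x; have [|_] := F_lab x; rewrite ?inE.
split=> x y; last by have [||_] := F_lt x y; rewrite ?inE.
by have [||<-] := F_lt x y; rewrite ?inE.
Qed.

(** Labels are moved to a permutation representing each graph. Embeddings of permutations are
    induced embeddings of inversion graphs, and the isomorphisms carry them back. *)
Lemma graph_lwqo_of_perm_lwqo (C : permutation -> Prop) :
  perm_lwqo C -> graph_lwqo (inversion_graphs C).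
Proof.
move=> C_lwqo L leL leL_wqo; have [leL_refl leL_trans] := leL_wqo.1.
split.
  split=> [G|G H K [f [[f_inj f_adj] f_lab]] [g [[g_inj g_adj] g_lab]]].
    by exists id; split; [split | move=> v; apply: leL_refl].
  exists (g \o f); split; first split=> [|x y] /=.
  - exact: inj_comp.
  - by rewrite f_adj g_adj.
  - by move=> v; apply: leL_trans (f_lab v) (g_lab _).
move=> G.
have rep i : exists p : labelled_perm C L, exists phi psi,
    [/\ cancel phi psi, cancel psi phi,
      (forall x y, adj x y = inversion (phi x) (phi y)) &
      forall k, lperm_label p k = lgraph_label (G i) (psi k)].
  have [p [Cp [phi [[psi phiK psiK] phi_adj]]]] := lgraph_in (G i).
  by exists (@LabelledPerm C L p Cp (fun k => lgraph_label (G i) (psi k))), phi, psi.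
pose w i := sval (constructive_indefinite_description _ (rep i)).
have wP i := svalP (constructive_indefinite_description _ (rep i)).
have [i [j [ij [f [/embedding_inversion[f_inj f_adj] f_lab]]]]] :=
  (C_lwqo L leL leL_wqo).2 w.
have [phi [psi [phiK psiK phi_adj phi_lab]]] := wP i.
have [phi' [psi' [phiK' psiK' phi_adj' phi_lab']]] := wP j.
exists i, j; split=> //; exists (psi' \o f \o phi); split; first split.
- exact: inj_comp (inj_comp (can_inj psiK') f_inj) (can_inj phiK).
- by move=> x y; rewrite phi_adj phi_adj' /= !psiK'; apply: f_adj.
- by move=> x; have := f_lab (phi x); rewrite phi_lab phi_lab' phiK.
Qed.

Theorem theorem7p17 (C : permutation -> Prop) (hC : perm_class C) :
  perm_lwqo C <-> graph_lwqo (inversion_graphs C).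
Proof.
split; first exact: graph_lwqo_of_perm_lwqo.
exact: perm_lwqo_of_graph_lwqo.
Qed.
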